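(* Let $\Gamma$ be a finite simple graph, $\tilde\Gamma$ the prime graph of $SEP(\Gamma)$, $p_n$ the $n$-th prime, and $k\ge2$ an integer. If $\Gamma$ has at least two structural equivalence classes, with $\alpha$ the size of a largest class and $\beta$ the size of a second largest class, then $\tilde\Gamma$ has a $k$-clique if and only if $\alpha\ge p_k+p_{k-1}$, or $\alpha\ge p_k$ and $\beta\ge p_{k-1}$. If $\Gamma$ has exactly one structural equivalence class, of size $\alpha$, then $\tilde\Gamma$ has a $k$-clique if and only if $\alpha\ge p_k+p_{k-1}$.
   Context: Two vertices $u,v$ of a graph $\Gamma$ are structurally equivalent if the transposition $(u\,v)$ (swapping $u,v$, fixing other vertices) is an automorphism of $\Gamma$; this is an equivalence relation whose classes are the structural equivalence classes. $SEP(\Gamma)=\langle\{(u\,v) : (u\,v)\in \mathrm{Aut}(\Gamma)\}\rangle$, which is isomorphic to the direct product of the symmetric groups on the classes. The prime graph of a finite group $G$ has as vertices the primes dividing $|G|$, distinct primes $p,q$ being adjacent iff $G$ has an element of order $pq$. *)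

(* Defs.v *)
From mathcomp Require Import all_boot all_fingroup.

Set Implicit Arguments.
Unset Strict Implicit.
Unset Printing Implicit Defensive.

Local Open Scope group_scope.

(* A finite simple graph is a symmetric irreflexive [e : rel T] on a finType. *)

Definition graph_aut (T : finType) (e : rel T) : {set {perm T}} :=
  [set s : {perm T} | [forall x, forall y, e (s x) (s y) == e x y]].

Definition struct_equiv (T : finType) (e : rel T) : rel T :=
  fun u v => tperm u v \in graph_aut e.

Definition struct_classes (T : finType) (e : rel T) : {set {set T}} :=
  equivalence_partition (struct_equiv e) [set: T].

(* The pairs with u = v only contribute the identity. *)
Definition SEP (T : finType) (e : rel T) : {group {perm T}} :=
  <<[set s in graph_aut e | [exists u, exists v, s == tperm u v]]>>%G.

Definition prime_graph (gT : finGroupType) (G : {group gT}) :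
    rel (seq_sub (primes #|G|)) :=
  fun p q => (p != q) && [exists x in G, #[x] == (val p * val q)%N].
Arguments prime_graph {gT} G p q.

Definition has_clique (V : finType) (e : rel V) (k : nat) : Prop :=
  exists K : {set V},
    #|K| = k /\ {in K &, forall x y, x != y -> e x y}.

Definition largest_block (T : finType) (P : {set {set T}}) (A : {set T}) :
    Prop :=
  A \in P /\ {in P, forall C : {set T}, #|C| <= #|A|}.

Lemma ex_prime_above (m : nat) : exists p, (m < p) && prime p.
Proof. by case: (prime_above m) => p mp pp; exists p; rewrite mp pp. Qed.

Definition next_prime (m : nat) : nat := ex_minn (ex_prime_above m).

(* One-based: nth_prime 1 = 2, nth_prime 2 = 3; the value nth_prime 0 = 0 is
   junk. *)
Definition nth_prime (n : nat) : nat := iter n next_prime 0.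

(* Main.v *)
(* A clique of size k contains primes p >= p_k and q >= p_(k-1) for which SEP
   has an element x of order pq.  Some cycle of x has length divisible by p and
   some cycle has length divisible by q; each lies in one class.  If they are
   in the same class, that class has at least p + q points, whether or not the
   two cycles coincide (pq >= p + q).  Conversely, disjoint sets of p and q
   points inside classes carry commuting permutations of orders p and q, so
   the size conditions make the first k primes a clique. *)
Require Import Defs.
From mathcomp Require Import all_boot all_fingroup.
From mathcomp Require Import cyclic pgroup.

(** * The enumeration of the primes *)

Lemma next_primeP m : m < next_prime m /\ prime (next_prime m).
Proof. by rewrite /next_prime; case: ex_minnP => n /andP[]. Qed.

Lemma next_prime_min m p : prime p -> m < p -> next_prime m <= p.
Proof.
by move=> pp mp; rewrite /next_prime; case: ex_minnP => n _; apply; rewrite mp.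
Qed.

Lemma nth_prime_prime n : prime (nth_prime n.+1).
Proof. by case: (next_primeP (nth_prime n)). Qed.

Lemma ltn_nth_prime : {homo nth_prime : i j / i < j}.
Proof.
apply: homo_ltn => [n m p|n]; first exact: ltn_trans.
by case: (next_primeP (nth_prime n)).
Qed.

Lemma leq_nth_prime : {homo nth_prime : i j / i <= j}.
Proof. exact/ltnW_homo/ltn_nth_prime. Qed.

Lemma prime_lt_nth_prime n p :
  prime p -> p < nth_prime n.+1 -> p \in [seq nth_prime i | i <- iota 1 n].
Proof.
move=> pp; elim: n => [|n IHn] lt_p.
  (* The junk value [nth_prime 0 = 0] lies below every prime, so [nth_prime 1] is a lower bound for
     all of them. *)
  by have:= next_prime_min 0 p pp (prime_gt0 pp); rewrite leqNgt lt_p.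
have: p <= nth_prime n.+1.
  rewrite leqNgt; apply: contraL lt_p => /(next_prime_min _ _ pp).
  by rewrite -leqNgt.
have ->: iota 1 n.+1 = rcons (iota 1 n) n.+1.
  by rewrite -[in LHS](addn1 n) iotaD cats1.
rewrite map_rcons mem_rcons inE leq_eqVlt.
by case/predU1P=> [->|/IHn->]; rewrite ?eqxx ?orbT.
Qed.

(** Pigeonhole: otherwise [s] would consist of more than [n] distinct primes, all among the first
    [n]. *)
Lemma exists_ge_nth_prime n (s : seq nat) :
  uniq s -> {in s, forall p, prime p} -> n < size s ->
  exists2 p, p \in s & nth_prime n.+1 <= p.
Proof.
move=> Us s_pr lt_n; apply/hasP; apply: contraLR lt_n => /hasPn s_lt.
rewrite -leqNgt -(size_iota 1 n) -(size_map nth_prime (iota 1 n)).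
apply: uniq_leq_size => // p sp.
by apply: prime_lt_nth_prime; rewrite ?s_pr // ltnNge s_lt.
Qed.

(** * Cliques of a prime graph as lists of primes *)

Lemma has_clique_prime_graphP (gT : finGroupType) (G : {group gT}) k :
  2 <= k ->
  has_clique (prime_graph G) k <->
  exists s : seq nat,
    [/\ uniq s, size s = k, {in s, forall p, prime p}
      & {in s &, forall p q, p != q -> exists2 x, x \in G & #[x]%g = p * q}].
Proof.
move=> k_ge2; split=> [[K [cardK cliqueK]] | [s [Us size_s s_pr s_ord]]].
  exists [seq val x | x <- enum K].
  rewrite map_inj_uniq ?enum_uniq ?size_map -?cardE ?cardK; last exact: val_inj.
  split=> // [_ /mapP[x _ ->] | _ _ /mapP[x + ->] /mapP[y + ->]].
    by have:= valP x; rewrite mem_primes => /andP[].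
  rewrite !mem_enum => Kx Ky neq_xy.
  have /andP[_ /exists_inP[g Gg /eqP og]] := cliqueK x y Kx Ky neq_xy.
  by exists g.
have s_dvd p : p \in s -> p \in primes #|G|.
  move=> sp; rewrite mem_primes s_pr ?cardG_gt0 //=.
  (* Since [2 <= k], some other prime [q] lies in [s]; the element of order [p * q] then shows that
     [p] divides [#|G|], so that [p] is a vertex. *)
  have /hasP[q sq neq_pq]: has (predC1 p) s.
    rewrite has_predC; apply: contraL k_ge2 => /allP s_p.
    rewrite -ltnNge ltnS -size_s.
    by apply: (uniq_leq_size (s2 := [:: p])) => // q /s_p; rewrite inE.
  rewrite /= eq_sym in neq_pq; have [x Gx ox] := s_ord p q sp sq neq_pq.
  by rewrite (dvdn_trans _ (order_dvdG Gx)) // ox dvdn_mulr.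
exists [set x | val x \in s]; split=> [|x y /[!inE] sx sy neq_xy].
  rewrite -size_s cardE -(size_map val); apply/perm_size/uniq_perm => //.
    by rewrite map_inj_uniq ?enum_uniq //; exact: val_inj.
  move=> p; apply/mapP/idP => [[x /[!mem_enum] /[!inE] sx -> //]|sp].
  by exists (SeqSub (s_dvd p sp)); rewrite ?mem_enum ?inE.
rewrite /prime_graph neq_xy; have [//|g Gg og] := s_ord _ _ sx sy.
by apply/exists_inP; exists g => //; apply/eqP.
Qed.

(** * Permutations: cycle lengths, orders and supports *)

Lemma order_porbit_dvd (T : finType) (s : {perm T}) n :
  (forall c, #|porbit s c| %| n) -> #[s]%g %| n.
Proof.
move=> s_n; rewrite order_dvdn; apply/eqP/permP => c.
have /dvdnP[m ->] := s_n c; rewrite perm1 permX iterM.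
by elim: m => //= m ->; apply: iter_porbit.
Qed.

(** Every cycle length divides [p * q]. If [p] divided none of them, each would be coprime to [p]
    and so divide [q], and the order [p * q] would divide [q]. *)
Lemma prime_dvd_porbit (T : finType) (s : {perm T}) p q :
  prime p -> prime q -> #[s]%g = p * q -> exists c, p %| #|porbit s c|.
Proof.
move=> pp pq os; apply/existsP; apply: contraT => /existsPn no_p.
suff: p * q %| q.
  rewrite -[X in _ %| X]mul1n dvdn_pmul2r ?prime_gt0 // dvdn1.
  by case: eqP pp => // ->.
rewrite -os; apply: order_porbit_dvd => c.
rewrite -(@Gauss_dvdr _ p); first by rewrite -os porbitE dvdn_orbit.
by rewrite coprime_sym prime_coprime.
Qed.

Lemma orbits_in_block (T : finType) (s : {perm T}) (C : {set T}) p q c d :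
  prime p -> prime q -> p != q ->
  p %| #|porbit s c| -> q %| #|porbit s d| ->
  porbit s c \subset C -> porbit s d \subset C -> p + q <= #|C|.
Proof.
move=> pp pq neq_pq p_c q_d cC dC.
have gt0 a : 0 < #|porbit s a| by rewrite lt0n card_porbit_neq0.
have [eq_cd|neq_cd] := eqVneq (porbit s c) (porbit s d).
  apply: leq_trans (subset_leq_card cC).
  have: p * q <= #|porbit s c|.
    rewrite dvdn_leq // Gauss_dvd ?p_c ?eq_cd //.
    by rewrite prime_coprime // dvdn_prime2.
  (* Primes are at least 2, which is what makes the product dominate the sum. *)
  apply: leq_trans; case: p q {p_c q_d neq_pq} pp pq => [|[|p]] [|[|q]] //= _ _.
  by rewrite mulnS leq_add2l mulSn -[q.+2]addn1 leq_add2l muln_gt0.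
have dis_cd: [disjoint porbit s c & porbit s d].
  rewrite disjoint_subset; apply/subsetP => x x_c; rewrite inE.
  by apply: contra neq_cd; move: x_c; rewrite -!eq_porbit_mem => /eqP->.
apply: (@leq_trans #|porbit s c :|: porbit s d|); last first.
  by rewrite subset_leq_card // subUset cC.
by rewrite cardsU disjoint_setI0 // cards0 subn0 leq_add // dvdn_leq.
Qed.

(** Induction on the number of moved points: following [s] by the transposition of [x] and [s x]
    makes [x] fixed and moves no new point. *)
Lemma perm_on_tperm_gen (T : finType) (C : {set T}) (G : {group {perm T}}) s :
  {in C &, forall x y, tperm x y \in G} -> perm_on C s -> s \in G.
Proof.
move=> CG; have [n] := ubnP #|[set x | s x != x]|.
elim: n s => // n IHn s /ltnSE le_n Cs.
have [s1 | [x]] := set_0Vmem [set x | s x != x].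
  suff ->: s = 1%g by apply: group1.
  apply/permP => x; rewrite perm1; apply/eqP.
  by have:= in_set0 x; rewrite -s1 inE => /negbFE.
rewrite inE => sx; have Cx: x \in C by apply: (subsetP Cs).
have Csx: s x \in C by rewrite perm_closed.
have on_t: perm_on C (tperm x (s x)).
  by apply: subset_trans (tperm_on _ _) _; rewrite subUset !sub1set Cx.
rewrite -(groupMr _ (CG _ _ Cx Csx)); apply: IHn; last exact: perm_onM.
apply: leq_trans le_n; apply/proper_card/properP; split.
  apply/subsetP => y; rewrite !inE permM; apply: contra => /eqP sy.
  rewrite sy; case: tpermP => // [yx | ysx]; first by rewrite -{1}yx sy yx.
  by rewrite (perm_inj (etrans sy ysx)).
by exists x; rewrite !inE ?permM ?tpermR ?eqxx.
Qed.

(** Cauchy's theorem in the symmetric group on [C], whose order is the factorial of [#|C|]. *)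
Lemma exists_perm_on_order (T : finType) (C : {set T}) p :
  prime p -> p <= #|C| -> exists2 s, perm_on C s & #[s]%g = p.
Proof.
move=> pp le_p; have: p %| #|Sym C| by rewrite card_Sym dvdn_fact ?prime_gt0.
by case/(Cauchy pp) => s; rewrite inE; exists s.
Qed.

(** * Structural equivalence classes and the action of [SEP e] on them *)

Section StructuralEquivalence.

Variables (T : finType) (e : rel T).

Lemma graph_autP (s : {perm T}) :
  reflect (forall x y, e (s x) (s y) = e x y) (s \in graph_aut e).
Proof.
rewrite inE; apply: (iffP forallP) => [s_e x y | s_e x].
  exact/eqP/(forallP (s_e x)).
by apply/forallP => y; rewrite s_e.
Qed.

Lemma graph_aut_group_set : group_set (graph_aut e).
Proof.
apply/group_setP; split=> [|s t /graph_autP se /graph_autP te].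
  by apply/graph_autP => x y; rewrite !perm1.
by apply/graph_autP => x y; rewrite !permM te se.
Qed.

Lemma struct_equiv_equivalence : equivalence_rel (struct_equiv e).
Proof.
pose A := group graph_aut_group_set.
have tr u v w : struct_equiv e u v -> struct_equiv e v w -> struct_equiv e u w.
  rewrite /struct_equiv => uv vw.
  have [<-|neq_vu] := eqVneq v u; first exact: vw.
  have [<-|neq_wu] := eqVneq w u; first by rewrite tperm1; apply: (group1 A).
  (* Transitivity is conjugation of one transposition by the other inside the automorphism group. *)
  have <-: (tperm u v ^ tperm v w)%g = tperm u w by rewrite tpermJ tpermL tpermD.
  exact: (@groupJ _ A).
move=> u v w; split=> [|uv].
  by rewrite /struct_equiv tperm1; apply: (group1 A).
by apply/idP/idP; apply: tr => //; rewrite /struct_equiv tpermC.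
Qed.

Lemma struct_classes_partition : partition (struct_classes e) [set: T].
Proof.
by apply: equivalence_partitionP => x y z *; apply: struct_equiv_equivalence.
Qed.

Lemma struct_classesP C :
  C \in struct_classes e ->
  {in C, forall x, C = [set y | struct_equiv e x y]}.
Proof.
case/imsetP=> x0 _ -> x /[!inE] /= x0x; apply/setP => y; rewrite !inE.
by have [_ ->] := struct_equiv_equivalence x0 x y.
Qed.

Lemma mem_struct_class x : [set y | struct_equiv e x y] \in struct_classes e.
Proof. by apply/imsetP; exists x => //; apply/setP => y; rewrite !inE. Qed.

Lemma tperm_SEP x y : struct_equiv e x y -> tperm x y \in SEP e.
Proof.
move=> xy; apply: mem_gen; rewrite in_set; apply/andP; split=> //.
by apply/existsP; exists x; apply/existsP; exists y.
Qed.

Lemma perm_on_SEP C s : C \in struct_classes e -> perm_on C s -> s \in SEP e.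
Proof.
move=> eC; apply: perm_on_tperm_gen => x y Cx Cy.
by apply: tperm_SEP; move: Cy; rewrite (struct_classesP _ eC x Cx) inE.
Qed.

Lemma SEP_struct_equiv s x : s \in SEP e -> struct_equiv e x (s x).
Proof.
have eqv := struct_equiv_equivalence.
(* The permutations preserving every class form a group, so it suffices that [H] contains the
   generators. *)
pose H := [set s : {perm T} | [forall x, struct_equiv e x (s x)]].
have gH: group_set H.
  apply/group_setP; split=> [|s1 s2 /[!inE] /forallP s1e /forallP s2e].
    by rewrite inE; apply/forallP => y; rewrite perm1; case: (eqv y y y).
  apply/forallP => y; rewrite permM.
  by have [_ ->] := eqv y (s1 y) (s2 (s1 y)).
suff /subsetP sGH: SEP e \subset group gH.
  by move=> /sGH; rewrite inE => /forallP.
rewrite gen_subG; apply/subsetP => t.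
rewrite !inE => /andP[te /existsP[u /existsP[v /eqP def_t]]].
have uv: struct_equiv e u v by rewrite /struct_equiv -def_t inE.
apply/forallP => y; rewrite def_t; case: tpermP => [->|->|_ _] //.
  by rewrite /struct_equiv tpermC.
by case: (eqv y y y).
Qed.

Lemma porbit_struct_class s x :
  s \in SEP e -> porbit s x \subset [set y | struct_equiv e x y].
Proof.
move=> Gs; apply/subsetP => _ /porbitP[i ->].
by rewrite inE SEP_struct_equiv ?groupX.
Qed.

Lemma SEP_order_classes s p q :
  prime p -> prime q -> p != q -> s \in SEP e -> #[s]%g = p * q ->
  exists C D, [/\ C \in struct_classes e, D \in struct_classes e,
    p <= #|C|, q <= #|D| & C = D -> p + q <= #|C|].
Proof.
move=> pp pq neq_pq Gs os.
have [c p_c] := prime_dvd_porbit _ _ _ _ pp pq os.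
have [d q_d] := prime_dvd_porbit _ _ _ _ pq pp (etrans os (mulnC p q)).
have cC := porbit_struct_class s c Gs; have dD := porbit_struct_class s d Gs.
have le_card r a (E : {set T}) :
    r %| #|porbit s a| -> porbit s a \subset E -> r <= #|E|.
  move=> r_a aE; apply: leq_trans (subset_leq_card aE).
  by rewrite dvdn_leq // lt0n card_porbit_neq0.
exists [set y | struct_equiv e c y], [set y | struct_equiv e d y].
split; try exact: mem_struct_class.
- exact: le_card p_c cC.
- exact: le_card q_d dD.
by move=> eqCD; apply: (orbits_in_block _ s _ p q c d) => //; rewrite eqCD.
Qed.

(** Permutations with disjoint supports commute, and coprime orders then multiply. Only [U] and [V]
    have to be disjoint: [C] and [D] may be the same class. *)
Lemma SEP_exists_order p q (C D U V : {set T}) :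
  prime p -> prime q -> p != q ->
  C \in struct_classes e -> D \in struct_classes e ->
  U \subset C -> V \subset D -> [disjoint U & V] ->
  p <= #|U| -> q <= #|V| -> exists2 s, s \in SEP e & #[s]%g = p * q.
Proof.
move=> pp pq neq_pq eC eD UC VD disUV pU qV.
have [s Us os] := exists_perm_on_order _ _ _ pp pU.
have [t Vt ot] := exists_perm_on_order _ _ _ pq qV.
exists (s * t)%g.
  apply: groupM; [apply: (perm_on_SEP C) | apply: (perm_on_SEP D)] => //.
    exact: subset_trans Us UC.
  exact: subset_trans Vt VD.
rewrite orderM ?os ?ot //; first exact: perm_onC Us Vt disUV.
by rewrite prime_coprime // dvdn_prime2.
Qed.

(** * Cliques in the prime graph of [SEP e] and class sizes *)

Lemma clique_SEP_classes k :
  2 <= k -> has_clique (prime_graph (SEP e)) k ->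
  exists C D, [/\ C \in struct_classes e, D \in struct_classes e,
    nth_prime k <= #|C|, nth_prime k.-1 <= #|D|
    & C = D -> nth_prime k + nth_prime k.-1 <= #|C|].
Proof.
move=> k_ge2 /(has_clique_prime_graphP _ _ _ k_ge2)[s [Us size_s s_pr s_ord]].
case: k k_ge2 size_s => [|[|k]] // _ size_s.
have [|p sp le_p] := exists_ge_nth_prime k.+1 s Us s_pr; first by rewrite size_s.
(* Deleting [p] leaves one prime fewer, which lowers the index of the guaranteed bound by one and
   makes [q] distinct from [p]. *)
have [||q] := exists_ge_nth_prime k (rem p s) (rem_uniq p Us).
- by move=> q /mem_rem; apply: s_pr.
- by rewrite size_rem // size_s.
rewrite (rem_filter _ Us) mem_filter => /andP[neq_qp sq] le_q.
have neq_pq: p != q by rewrite eq_sym.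
have [x Gx ox] := s_ord p q sp sq neq_pq.
have [C [D [eC eD pC qD CD]]] :=
  SEP_order_classes x p q (s_pr _ sp) (s_pr _ sq) neq_pq Gx ox.
exists C, D; split=> //; [exact: leq_trans pC | exact: leq_trans qD |].
by move/CD; apply: leq_trans; apply: leq_add.
Qed.

Lemma clique_SEP k :
  2 <= k ->
  (exists C D U V : {set T},
     [/\ C \in struct_classes e, D \in struct_classes e
       & [/\ U \subset C, V \subset D, [disjoint U & V],
             nth_prime k <= #|U| & nth_prime k.-1 <= #|V|]]) ->
  has_clique (prime_graph (SEP e)) k.
Proof.
move=> k_ge2 [C [D [U [V [eC eD [UC VD disUV pU pV]]]]]].
apply/has_clique_prime_graphP => //; exists [seq nth_prime i | i <- iota 1 k].
have inj_p: injective nth_prime by apply: incn_inj; apply: leq_mono ltn_nth_prime.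
rewrite map_inj_uniq // iota_uniq size_map size_iota; split=> //.
  by move=> _ /mapP[[|i]] /[!mem_iota] // _ ->; apply: nth_prime_prime.
(* One pair [U], [V] serves all edges: the larger prime has index at most [k] and fits in [U], the
   smaller has index at most [k.-1] and fits in [V]. *)
have ord i j : 0 < i < j -> j <= k ->
    exists2 s, s \in SEP e & #[s]%g = nth_prime j * nth_prime i.
  case: i j k {k_ge2} pU pV => [|i] [|j] [|k] // pU pV /andP[_ lt_ij] le_jk.
  apply: (@SEP_exists_order _ _ C D U V) => //; try exact: nth_prime_prime.
  - by rewrite (inj_eq inj_p) gtn_eqF.
  - exact/(leq_trans _ pU)/leq_nth_prime.
  - by apply/(leq_trans _ pV)/leq_nth_prime; exact: (@leq_trans j).
move=> _ _ /mapP[i + ->] /mapP[j + ->]; rewrite !mem_iota add1n !ltnS.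
move=> /andP[i0 ik] /andP[j0 jk]; rewrite (inj_eq inj_p) neq_ltn.
case/orP=> lt; last by apply: ord; rewrite ?j0.
by rewrite mulnC; apply: ord; rewrite ?i0.
Qed.

Lemma clique_SEP_one_class k C :
  2 <= k -> C \in struct_classes e -> nth_prime k + nth_prime k.-1 <= #|C| ->
  has_clique (prime_graph (SEP e)) k.
Proof.
move=> k_ge2 eC le_C.
have [U UC cU] : exists2 U : {set T}, U \subset C & #|U| = nth_prime k.
  have: 0 < #|[set U : {set T} | U \subset C & #|U| == nth_prime k]|.
    by rewrite cards_draws bin_gt0 (leq_trans _ le_C) ?leq_addr.
  by case/card_gt0P=> U /[!inE] /andP[UC /eqP]; exists U.
apply: clique_SEP => //; exists C, C, U, (C :\: U); split=> //; split=> //.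
- exact: subsetDl.
- by rewrite -setI_eq0 setIDA setDIl setDv set0I.
- by rewrite cU.
rewrite cardsD (setIidPr UC) cU.
by rewrite leq_subRL ?(leq_trans _ le_C) ?leq_addr.
Qed.

End StructuralEquivalence.

Theorem theorem3p2 (T : finType) (e : rel T)
    (e_sym : symmetric e) (e_irr : irreflexive e) (k : nat) (k_ge2 : 2 <= k) :
  (2 <= #|struct_classes e| ->
   forall A B : {set T},
     largest_block (struct_classes e) A ->
     largest_block (struct_classes e :\ A) B ->
     (has_clique (prime_graph (SEP e)) k <->
      nth_prime k + nth_prime k.-1 <= #|A| \/
      (nth_prime k <= #|A| /\ nth_prime k.-1 <= #|B|)))
  /\
  (#|struct_classes e| = 1 ->
   forall A : {set T},
     A \in struct_classes e ->
     (has_clique (prime_graph (SEP e)) k <->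
      nth_prime k + nth_prime k.-1 <= #|A|)).
Proof.
split=> [_ A B [eA maxA] [/setD1P[neq_BA eB] maxB] | /eqP/cards1P[A0 eqA0] A eA].
  split=> [/(clique_SEP_classes _ _ _ k_ge2)[C [D [eC eD pC qD CD]]] | [le_A | [le_A le_B]]].
  - have [eqCD | neq_CD] := eqVneq C D.
      by left; apply: leq_trans (CD eqCD) (maxA _ eC).
    right; split; first exact: leq_trans pC (maxA _ eC).
    (* If [C] is [A], then [D] is another class and [B] is at least as large as [D]. Otherwise [B]
       is at least as large as [C], which already has [nth_prime k] points. *)
    have [eqCA | neq_CA] := eqVneq C A.
      by apply: leq_trans qD (maxB _ _); rewrite !inE eD -eqCA eq_sym neq_CD.
    apply: (leq_trans (leq_nth_prime _ _ (leq_pred k))).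
    by apply: leq_trans pC (maxB _ _); rewrite !inE eC neq_CA.
  - exact: clique_SEP_one_class le_A.
  apply: clique_SEP => //; exists A, B, A, B; split=> //; split=> //.
  have /and3P[_ /trivIsetP tI _] := struct_classes_partition _ e.
  by apply: tI; rewrite // eq_sym.
split=> [/(clique_SEP_classes _ _ _ k_ge2)[C [D [eC eD _ _ CD]]] |]; last first.
  exact: clique_SEP_one_class.
move: eA eC eD CD; rewrite eqA0 => /set1P-> /set1P-> /set1P-> CD.
exact: CD.
Qed.
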